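(* Let $\{X_k\mid k\in\mathbb{Z}\}$ be a zero-mean wide-sense stationary (real-valued) process with power spectral density $S(e^{j2\pi f})$. Let $\mathbf{C}_n$ be the covariance matrix of $n$ consecutive samples, $M_n\triangleq\frac1n\operatorname{trace}\{\mathbf{C}_n^{-1}\}$, and $M_\infty\triangleq\lim_{n\to\infty}M_n$. Let $\overleftrightarrow{\mathcal{E}^2}$ denote the linear minimum mean square error in predicting $X_i$ given the entire past and future $\{X_\ell\mid \ell\in\mathbb{Z}\setminus\{i\}\}$. Then $$M_\infty=\frac{1}{\overleftrightarrow{\mathcal{E}^2}}=\int_{-1/2}^{1/2}\frac{df}{S(e^{j2\pi f})}.$$
   Context: For a zero-mean wide-sense stationary process, $c_\ell\triangleq\mathbb{E}\{X_{i+\ell}X_i\}$, and $\mathbf{C}_n$ is the $n\times n$ symmetric Toeplitz matrix with $(i,j)$ entry $c_{|i-j|}$. The power spectral density is $S(e^{j2\pi f})\triangleq\sum_{\ell=-\infty}^{\infty}c_\ell e^{-j2\pi f\ell}$, with $j=\sqrt{-1}$, where the sum is assumed to converge for all $f\in\mathbb{R}$. The two-sided prediction error $\overleftrightarrow{\mathcal{E}^2}$ is the infimum of $\mathbb{E}\{(X_i-Y)^2\}$ over all (finite) real linear combinations $Y$ of $\{X_\ell\mid\ell\in\mathbb{Z}\setminus\{i\}\}$; by stationarity it does not depend on $i$. Conventions: $1/0\triangleq\infty$, and $\operatorname{trace}\{\mathbf{A}^{-1}\}\triangleq\infty$ for a singular positive semidefinite matrix $\mathbf{A}$; quantities may take the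 value $\infty$. (The sequence $M_n$ is non-decreasing, so the limit exists in $(0,\infty]$.) *)

(* Defs.v *)
From HB Require Import structures.
From mathcomp Require Import all_boot all_order all_algebra.
From mathcomp Require Import finmap complex.
From mathcomp Require Import all_classical all_reals all_analysis.

Set Implicit Arguments.
Unset Strict Implicit.
Unset Printing Implicit Defensive.

Import Order.TTheory GRing.Theory Num.Theory.
Import numFieldNormedType.Exports.

Local Open Scope classical_set_scope.
Local Open Scope ring_scope.

Section StationaryProcess.
Context d (T : measurableType d) (R : realType) (P : probability T R).
Implicit Types X : int -> {RV P >-> R}.

Definition zero_mean_wss X : Prop :=
  [/\ forall k, (X k : T -> R) \in Lfun P 2%:E,
      forall k, ('E_P[X k] = 0)%E
    & forall i j l : int,
        ('E_P[fun w => (X (i + l) w * X i w)%R] =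
         'E_P[fun w => (X (j + l) w * X j w)%R])%E].

(* The base index 0 is immaterial and the expectation is finite
   under [zero_mean_wss X]. *)
Definition autocov X (l : int) : R :=
  fine 'E_P[fun w => (X (0 + l) w * X 0 w)%R]%E.

Definition cov_mx X (n : nat) : 'M[R]_n :=
  \matrix_(i < n, j < n) autocov X `|i%:Z - j%:Z|.

(* An infimum over all finite linear combinations of the other samples, with
   index set [A] and real coefficients [a]. *)
Definition two_sided_error X (i : int) : \bar R :=
  ereal_inf [set e | exists (A : {fset int}) (a : int -> R),
    i \notin A /\
    e = 'E_P[fun w => ((X i w - \sum_(l <- A) a l * X l w) ^+ 2)%R]%E].

End StationaryProcess.

Definition trace_inv (R : realType) (n : nat) (A : 'M[R]_n) : \bar R :=
  if A \in unitmx then (\tr (invmx A))%:E else +oo%E.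

Definition mean_trace_inv d (T : measurableType d) (R : realType)
    (P : probability T R) (X : int -> {RV P >-> R}) (n : nat) : \bar R :=
  ((n%:R^-1)%:E * trace_inv (cov_mx X n))%E.

(* e^{jt} *)
Definition expj (R : realType) (t : R) : R[i] := Complex (cos t) (sin t).

(* Partial sum over -N <= l <= N, with l = k - N. *)
Definition psd_partial (R : realType) (c : int -> R) (f : R) (N : nat) : R[i] :=
  \sum_(k < N.*2.+1) let l : int := k%:Z - N%:Z in
    real_complex R (c l) * expj (- (2 * pi * f * l%:~R)).

(* The series converges at every frequency [f], with sum [S f].  The sum is
   real because [c] is even for a real process.  Convergence is that of the
   symmetric partial sums, the weakest usual reading of a bilateral series. *)
Definition is_psd (R : realType) (c : int -> R) (S : R -> R) : Prop :=
  forall f : R,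
    psd_partial c f @ \oo --> (real_complex R (S f) : R[i]^o).

(* Main.v *)
Require Import Defs.
From HB Require Import structures.
From mathcomp Require Import all_boot all_order all_algebra.
From mathcomp Require Import finmap complex.
From mathcomp Require Import all_classical all_reals all_analysis.
From mathcomp Require Import measurable_realfun ring lra zify.

Set Implicit Arguments.
Unset Strict Implicit.
Unset Printing Implicit Defensive.

Import Order.TTheory GRing.Theory Num.Theory.
Import numFieldNormedType.Exports.

Local Open Scope classical_set_scope.
Local Open Scope ring_scope.

(* For a positive definite C, (C^-1)_ii is the inverse of the minimum of
   x C x^T under x_i = 1, i.e. of the error in predicting the i-th sample from
   the other ones in the window.  All but boundedly many rows of C_n see any
   prescribed finite window around them, so M_n tends to 1/E.

   The integral is compared with 1/E without a spectral measure, through the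
   Fejer means s_n(f) = v^* C_n v / n, v = (e^(2 pi j f k))_k, which are
   nonnegative and tend to S(f) by Cesaro summation.
   - Since v^* C_n^-1 v >= (v^* v)^2 / (v^* C_n v) = n / s_n(f), integration in
     f gives M_n >= int 1/s_n, and Fatou's lemma gives 1/E >= int 1/S.
   - If x_k0 = 1 and p(f) = sum_k x_k e^(2 pi j f k), then
     Re(p e^(-2 pi j f k0)) has integral 1 and Fatou's lemma gives
     int |p|^2 S <= lim int |p|^2 s_n = x C x^T, so that
     1 <= (x C x^T) (int 1/S) by Cauchy-Schwarz, hence 1/E <= int 1/S. *)

(** * Quadratic forms and inverse matrices *)

Definition mxform (R : pzRingType) n (A : 'M[R]_n) (x : 'rV[R]_n) : R :=
  (x *m A *m x^T) 0 0.

Lemma mxformE (R : comPzRingType) n (A : 'M[R]_n) (x : 'rV[R]_n) :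
  mxform A x = \sum_(i < n) \sum_(j < n) x 0 i * x 0 j * A i j.
Proof.
rewrite /mxform mxE exchange_big/=; apply: eq_bigr => j _.
rewrite !mxE mulr_suml; apply: eq_bigr => i _.
by rewrite -!mulrA [A i j * _]mulrC.
Qed.

(** Nonnegativity of the form at [y *m invmx A - t *: x]. Keeping [t] free gives Cauchy-Schwarz
    without dividing by [mxform A x], which may vanish. *)
Lemma mxform_invmx_ge (R : realFieldType) n (A : 'M[R]_n) (t : R)
    (x y : 'rV[R]_n) : A^T = A -> (forall z, 0 <= mxform A z) -> A \in unitmx ->
  2 * t * (y *m x^T) 0 0 <= mxform (invmx A) y + t ^+ 2 * mxform A x.
Proof.
move=> Asym Apsd Au; pose B := invmx A.
have Bsym : B^T = B by rewrite /B trmx_inv Asym.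
have := Apsd (y *m B - t *: x).
have -> : mxform A (y *m B - t *: x) =
  mxform B y - 2 * t * (y *m x^T) 0 0 + t ^+ 2 * mxform A x.
  rewrite /mxform mulmxBl mulmxKV// linearB/= trmx_mul Bsym linearZ/=.
  rewrite mulmxBr !mulmxBl -!scalemxAl -!scalemxAr.
  have -> : x *m A *m (B *m y^T) = (y *m x^T)^T.
    by rewrite -mulmxA (mulmxA A) mulmxV// mul1mx trmx_mul trmxK.
  by rewrite !mulmxA !mxE; ring.
lra.
Qed.

(** Cauchy-Schwarz for [x] and the [i]-th unit vector, whose pairing is [x 0 i = 1]. *)
Lemma invmx_diag_form_ge1 (R : realFieldType) n (A : 'M[R]_n) (i : 'I_n)
    (x : 'rV[R]_n) : A^T = A -> (forall z, 0 <= mxform A z) -> A \in unitmx ->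
  x 0 i = 1 -> 1 <= invmx A i i * mxform A x.
Proof.
move=> Asym Apsd Au xi1; set b := invmx A i i; set q := mxform A x.
have ineq t : 2 * t <= b + t ^+ 2 * q.
  have := mxform_invmx_ge t x (delta_mx 0 i) Asym Apsd Au.
  have -> : mxform (invmx A) (delta_mx 0 i) = b.
    by rewrite /mxform -rowE trmx_delta -colE !mxE.
  by rewrite -rowE !mxE xi1 mulr1.
have q0 : 0 <= q by exact: Apsd.
have b0 : 0 <= b by have := ineq 0; nra.
have [bq|//] := ltP (b * q) 1; exfalso.
have [b_eq0|b_neq0] := eqVneq b 0.
  (* With [b = 0], the choice [t = 1 / (q + 1)] would give [2 t <= t^2 q < t]. *)
  have := ineq (1 / (q + 1)); rewrite b_eq0 add0r.
  rewrite expr_div_n expr1n mulrAC -subr_ge0.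
  suff : 2 * (1 / (q + 1)) > 1 / (q + 1) ^+ 2 * q by lra.
  have q1 : 0 < (q + 1)^-1 by rewrite invr_gt0; lra.
  have e : (q + 1)^-1 * q = 1 - (q + 1)^-1.
    by field; rewrite gt_eqF//; lra.
  rewrite !div1r expr2 invfM -mulrA e; nra.
(* The choice [t = b] gives [2 b <= b + b (b q)], against [b q < 1] and [b > 0]. *)
have := ineq b; nra.
Qed.

Lemma mxform_row_invmx (R : realFieldType) n (A : 'M[R]_n) (i : 'I_n) :
  A^T = A -> A \in unitmx -> mxform A (row i (invmx A)) = invmx A i i.
Proof.
move=> Asym Au; rewrite /mxform rowE mulmxKV// trmx_mul trmx_inv Asym.
by rewrite trmx_delta -colE -rowE !mxE.
Qed.

Lemma mxformZ (R : comPzRingType) n (A : 'M[R]_n) (a : R) (x : 'rV[R]_n) :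
  mxform A (a *: x) = a ^+ 2 * mxform A x.
Proof.
by rewrite /mxform linearZ/= -scalemxAr -!scalemxAl !mxE mulrA.
Qed.

(** Equality case: the minimizer is the [i]-th row of the inverse, scaled to have [i]-th entry 1. *)
Lemma invmx_diag_form_attained (R : realFieldType) n (A : 'M[R]_n) (i : 'I_n) :
  A^T = A -> (forall z, 0 <= mxform A z) -> A \in unitmx ->
  exists2 x : 'rV[R]_n, x 0 i = 1 & mxform A x = (invmx A i i)^-1.
Proof.
move=> Asym Apsd Au.
have b0 : invmx A i i != 0.
  have := @invmx_diag_form_ge1 _ _ A i (delta_mx 0 i) Asym Apsd Au.
  rewrite mxE !eqxx => /(_ erefl); apply: contraTneq => ->.
  by rewrite mul0r -ltNge ltr01.
exists ((invmx A i i)^-1 *: row i (invmx A)).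
  by rewrite !mxE mulVf.
by rewrite mxformZ mxform_row_invmx// expr2 -mulrA mulVf// mulr1.
Qed.

(** A kernel vector, scaled at a nonzero entry. For a covariance matrix it expresses one sample of
    the window exactly through the others. *)
Lemma singular_mxform0 (R : fieldType) n (A : 'M[R]_n) : A \notin unitmx ->
  exists (i : 'I_n) (x : 'rV[R]_n), x 0 i = 1 /\ mxform A x = 0.
Proof.
rewrite unitmxE unitfE negbK => /det0P[v /rV0Pn[i vi0] vA0].
exists i, ((v 0 i)^-1 *: v); split; first by rewrite mxE mulVf.
by rewrite mxformZ /mxform vA0 mul0mx mxE mulr0.
Qed.

(** * Toeplitz covariances and prediction within a window *)

(** The index is the signed difference, so that sums over entries reindex without absolute values;
    evenness of [autocov] identifies this with [cov_mx]. *)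
Definition toeplitz_mx (R : Type) (c : int -> R) n : 'M[R]_n :=
  \matrix_(i < n, j < n) c (i%:Z - j%:Z).

Lemma tr_toeplitz_mx (R : Type) (c : int -> R) n :
  (forall m, c (- m) = c m) -> (toeplitz_mx c n)^T = toeplitz_mx c n.
Proof.
by move=> cN; apply/matrixP => i j; rewrite !mxE -cN opprB.
Qed.

Lemma autocovE d (T : measurableType d) (R : realType) (P : probability T R)
    (X : int -> {RV P >-> R}) : zero_mean_wss X -> forall k l : int,
  ('E_P[fun w => (X k w * X l w)%R] = (autocov X (k - l))%:E)%E.
Proof.
move=> [X2 _ Xstat] k l; rewrite /autocov (Xstat 0 l) addrC subrK fineK//.
rewrite unlock; apply: integrable_fin_num => //.
exact/Lfun1_integrable/Lfun2_mul_Lfun1.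
Qed.

Lemma autocovN d (T : measurableType d) (R : realType) (P : probability T R)
    (X : int -> {RV P >-> R}) : zero_mean_wss X -> forall m : int,
  autocov X (- m) = autocov X m.
Proof.
move=> hX m; apply: EFin_inj; have := autocovE hX 0 m.
rewrite sub0r => <-; have := autocovE hX m 0; rewrite subr0 => <-.
by congr ('E_P[_])%E; apply/funext => w; rewrite mulrC.
Qed.

Lemma cov_mxE d (T : measurableType d) (R : realType) (P : probability T R)
    (X : int -> {RV P >-> R}) : zero_mean_wss X -> forall n,
  cov_mx X n = toeplitz_mx (autocov X) n.
Proof.
move=> hX n; apply/matrixP => i j; rewrite !mxE.
by case: ger0P => // _; rewrite autocovN.
Qed.

(** The start [s] of the window drops out by stationarity, so one coefficient vector has the same
    error at every position. *)
Lemma expectation_sqr_sum d (T : measurableType d) (R : realType)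
    (P : probability T R) (X : int -> {RV P >-> R}) (s : int) n (x : 'rV[R]_n) :
  zero_mean_wss X ->
  ('E_P[fun w => ((\sum_(k < n) x 0 k * X (s + k%:Z) w) ^+ 2)%R] =
   (mxform (toeplitz_mx (autocov X) n) x)%:E)%E.
Proof.
move=> hX; have [X2 _ _] := hX; rewrite unlock.
pose XX k l w := X (s + k%:Z) w * X (s + l%:Z) w.
have XXint k l : P.-integrable setT (EFin \o XX k l).
  exact/Lfun1_integrable/Lfun2_mul_Lfun1.
transitivity (\int[P]_w (\sum_(p : 'I_n * 'I_n)
    (x 0 p.1 * x 0 p.2)%:E * (XX p.1 p.2 w)%:E))%E.
  apply: eq_integral => w _.
  under [RHS]eq_bigr do rewrite -EFinM.
  rewrite sumEFin expr2 big_distrlr/= pair_big/=; congr EFin.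
  by apply: eq_bigr => p _; rewrite mulrACA.
rewrite integral_sum//; last by move=> p; exact: (integrableZl _ _ (XXint _ _)).
rewrite mxformE pair_big -sumEFin; apply: eq_bigr => p _/=.
rewrite integralZl; [|by []|exact: XXint]; rewrite [RHS]EFinM mxE; congr mule.
have := autocovE hX (s + (p.1)%:Z) (s + (p.2)%:Z); rewrite unlock => ->.
by rewrite opprD addrACA subrr add0r.
Qed.

Lemma toeplitz_autocov_ge0 d (T : measurableType d) (R : realType)
    (P : probability T R) (X : int -> {RV P >-> R}) n (x : 'rV[R]_n) :
  zero_mean_wss X -> 0 <= mxform (toeplitz_mx (autocov X) n) x.
Proof.
move=> hX; rewrite -lee_fin -(expectation_sqr_sum 0 x hX).
by apply: expectation_ge0 => w; exact: sqr_ge0.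
Qed.

(** Serves to turn a predictor over a finite index set into a coefficient vector on a window. *)
Lemma big_fset_window (V : nmodType) (A : {fset int}) (s : int) n (F : int -> V) :
  {in A, forall l, (s <= l < s + n%:Z)} ->
  \sum_(l <- A) F l = \sum_(k < n | s + k%:Z \in A) F (s + k%:Z).
Proof.
move=> As.
rewrite -(big_mkord (fun k => s + k%:Z \in A) (fun k => F (s + k%:Z))).
rewrite /index_iota subn0.
rewrite -(big_map (fun k : nat => s + k%:Z) (mem A) F) -big_filter.
apply: perm_big; apply: uniq_perm; first exact: fset_uniq.
  by rewrite filter_uniq// map_inj_uniq ?iota_uniq// => a b; lia.
move=> l; rewrite mem_filter; have [lA|/negPf lA] := boolP (l \in A);
  last by rewrite /= lA.
rewrite /= lA; apply/esym/mapP; have := As _ lA => sl.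
by exists `|l - s|%N; rewrite ?mem_iota; lia.
Qed.

(** The window is placed with position [k0] on [i]; then [x] lists the coefficients of [X i - Y],
    where the predictor [Y] has coefficients [- x] at the other positions. *)
Lemma two_sided_error_lb d (T : measurableType d) (R : realType)
    (P : probability T R) (X : int -> {RV P >-> R}) (i : int) n (k0 : 'I_n)
    (x : 'rV[R]_n) : zero_mean_wss X -> x 0 k0 = 1 ->
  (two_sided_error X i <= (mxform (toeplitz_mx (autocov X) n) x)%:E)%E.
Proof.
move=> hX xk0; apply: ereal_inf_lbound; pose s := i - k0%:Z.
pose r := [seq s + (k : 'I_n)%:Z | k <- [seq k <- enum 'I_n | k != k0]].
pose A := [fset l in r]%fset.
(* At most one [k] satisfies the condition, so the sum reads off a single entry, and is 0 outside
   the window. *)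
pose a l := - \sum_(k < n | s + k%:Z == l) x 0 k.
have AE (k : 'I_n) : (s + k%:Z \in A) = (k != k0).
  rewrite inE; apply/mapP/idP => [[k']|kk0]; last first.
    by exists k; rewrite // mem_filter kk0 mem_enum.
  by rewrite mem_filter => /andP[k'k0 _] /addrI[] /ord_inj ->.
have aE (k : 'I_n) : a (s + k%:Z) = - x 0 k.
  rewrite /a (big_pred1 k)// => k'/=.
  by rewrite (inj_eq (addrI _)).
exists A, a; split.
  have -> : i = s + k0%:Z by rewrite subrK.
  by rewrite AE eqxx.
rewrite -(expectation_sqr_sum s)//; congr ('E_P[_])%E; apply/funext => w.
congr (_ ^+ 2).
rewrite (@big_fset_window _ _ s n); last first.
  move=> l; rewrite inE => /mapP[k _ ->]; have := ltn_ord k; lia.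
rewrite (bigD1 k0)//= xk0 mul1r subrK; congr (_ + _).
rewrite -sumrN; apply: eq_big => [k|k _]; first by rewrite AE.
by rewrite aE mulNr opprK.
Qed.

(** A predictor with error [q < e] uses finitely many samples, all within distance [m] of [i]. It
    fits into any window with [m] positions on each side of [k0], always with the same error. *)
Lemma two_sided_error_window d (T : measurableType d) (R : realType)
    (P : probability T R) (X : int -> {RV P >-> R}) (i : int) (e : \bar R) :
  zero_mean_wss X -> (two_sided_error X i < e)%E ->
  exists (m : nat) (q : R), (q%:E < e)%E /\
    forall n (k0 : 'I_n), (m <= k0)%N -> (k0 + m < n)%N ->
      exists2 x : 'rV[R]_n, x 0 k0 = 1 &
        mxform (toeplitz_mx (autocov X) n) x = q.
Proof.
move=> hX /ereal_inf_lt[_ [A [a [iA ->]]] qe].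
(* A crude radius: the sum of all distances dominates each of them. *)
pose m := (\sum_(l <- A) `|l - i|)%N.
have Am l : l \in A -> (`|l - i| <= m)%N.
  by move=> lA; rewrite /m (big_fsetD1 l)//= leq_addr.
pose x n (k0 : 'I_n) : 'rV[R]_n := \row_k
  ((k == k0)%:R - (if i - k0%:Z + k%:Z \in A then a (i - k0%:Z + k%:Z) else 0)).
have xE n (k0 : 'I_n) : (m <= k0)%N -> (k0 + m < n)%N ->
  ('E_P[fun w => ((X i w - \sum_(l <- A) a l * X l w) ^+ 2)%R] =
    (mxform (toeplitz_mx (autocov X) n) (x n k0))%:E)%E.
  move=> mk0 k0m; rewrite -(expectation_sqr_sum (i - k0%:Z))//.
  congr ('E_P[_])%E; apply/funext => w; congr (_ ^+ 2).
  rewrite (@big_fset_window _ _ (i - k0%:Z) n); last by move=> l /Am; lia.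
  under [RHS]eq_bigr do rewrite mxE mulrBl.
  rewrite sumrB; congr (_ - _).
    rewrite (bigD1 k0)//= eqxx mul1r subrK big1 ?addr0// => k /negPf ->.
    by rewrite mul0r.
  rewrite big_mkcond; apply: eq_bigr => k _; case: ifP => // _.
  by rewrite mul0r.
(* The smallest admissible window, [2 m + 1] samples around position [m], serves to name the error
   as a real number. *)
have mE : (m < m + m.+1)%N by lia.
have q1 := xE (m + m.+1)%N (Ordinal mE) (leqnn m) ltac:(rewrite /=; lia).
exists m, (mxform (toeplitz_mx (autocov X) _) (x _ (Ordinal mE))).
split; first by rewrite -q1.
move=> n k0 mk0 k0m; exists (x n k0).
  by rewrite mxE eqxx subrK (negPf iA) subr0.
by apply: EFin_inj; rewrite -xE// q1.
Qed.

(** * Convergence of the normalised traces to 1/E *)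

Lemma cvge_from_below (R : realType) (u : (\bar R)^nat) (l : \bar R) :
  (forall n, (u n <= l)%E) ->
  (forall r : R, (r%:E < l)%E -> \forall n \near \oo, (r%:E <= u n)%E) ->
  u @ \oo --> l.
Proof.
case: l => [l| |] ul lu; last first.
- apply: cvg_near_cst; apply: nearW => n.
  by apply/eqP; rewrite eq_le ul leNye.
- by apply/cvgeyPge => r; apply: lu; rewrite ltry.
- have u_fin : \forall n \near \oo, u n \is a fin_num.
    near=> n; rewrite fin_numElt (le_lt_trans (ul n)) ?ltry// andbT.
    rewrite (@lt_le_trans _ _ (l - 1)%:E) ?ltNyr//.
    by near: n; apply: lu; rewrite lte_fin; lra.
  apply/fine_cvgP; split => //; apply/cvgrPdist_le => e e0.
  near=> n; have unfin : u n \is a fin_num by near: n.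
  have lun : ((l - e)%:E <= u n)%E by near: n; apply: lu; rewrite lte_fin; lra.
  have := ul n; move: lun => /=; rewrite -(fineK unfin) !lee_fin => h1 h2.
  by rewrite ger0_norm; lra.
Unshelve. all: by end_near. Qed.

Section mean_trace.
Context d (T : measurableType d) (R : realType) (P : probability T R).
Variables (X : int -> {RV P >-> R}) (i : int).
Hypothesis hX : zero_mean_wss X.

Let C n := toeplitz_mx (autocov X) n.

Let Csym n : (C n)^T = C n.
Proof. by apply: tr_toeplitz_mx; exact: autocovN. Qed.

Let Cpsd n (z : 'rV[R]_n) : 0 <= mxform (C n) z.
Proof. exact: toeplitz_autocov_ge0. Qed.

Lemma two_sided_error_ge0 : (0 <= two_sided_error X i)%E.
Proof.
apply: le_ereal_inf_tmp => _ [A [a [_ ->]]].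
by apply: expectation_ge0 => w; exact: sqr_ge0.
Qed.

Let y_ge0 n (k : 'I_n) : C n \in unitmx -> 0 <= invmx (C n) k k.
Proof. by move=> Cu; rewrite -mxform_row_invmx. Qed.

(** A kernel vector gives an error-free predictor for one window position, which
    [two_sided_error_lb] moves onto [i]. *)
Lemma singular_two_sided_error n :
  toeplitz_mx (autocov X) n \notin unitmx -> two_sided_error X i = 0%E.
Proof.
move=> /singular_mxform0[k [x [xk1 x0]]]; apply/eqP.
rewrite eq_le two_sided_error_ge0 andbT -[leRHS]/(0%:E) -x0.
exact: two_sided_error_lb xk1.
Qed.

(** The inverse of the diagonal entry is the error of one predictor, hence at least the infimum. *)
Lemma invmx_diag_le n (k : 'I_n) : toeplitz_mx (autocov X) n \in unitmx ->
  ((invmx (toeplitz_mx (autocov X) n) k k)%:E <= (two_sided_error X i)^-1)%E.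
Proof.
move=> Cu; have [x xk1 xE] := invmx_diag_form_attained k (Csym n) (@Cpsd n) Cu.
have := invmx_diag_form_ge1 (Csym n) (@Cpsd n) Cu xk1.
have [->|y0 _] := eqVneq (invmx (C n) k k) 0; first by rewrite mul0r ler10.
rewrite inve_pge ?inE ?lee_fin ?y_ge0//; last exact: two_sided_error_ge0.
rewrite inver (negPf y0) -xE; exact: two_sided_error_lb xk1.
Qed.

Lemma mean_trace_inv_le n :
  (mean_trace_inv X n <= (two_sided_error X i)^-1)%E.
Proof.
rewrite /mean_trace_inv /trace_inv cov_mxE//; case: ifPn => [Cu|]; last first.
  by move/singular_two_sided_error ->; rewrite inve0 leey.
have := fun k : 'I_n => invmx_diag_le k Cu.
have : (0 <= (two_sided_error X i)^-1)%E by rewrite inve_ge0 two_sided_error_ge0.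
case: (_^-1)%E => [r r0 yr|_ _|//]; last by rewrite leey.
rewrite -EFinM lee_fin.
(* For [n = 0] the factor [n^-1] is 0 by convention, and so is the mean. *)
case: n => [|n] in Cu yr *; first by rewrite invr0 mul0r.
rewrite ler_pdivrMl// mulr_natl -[n.+1 in leRHS]card_ord -sumr_const.
by apply: ler_sum => k _; rewrite -lee_fin.
Qed.

(** Some predictor has error [q] with [u q < 1]. The [n - 2 m] rows at distance at least [m] from
    both ends have diagonal entry at least [1 / q], and their share of all rows tends to 1. *)
Lemma mean_trace_inv_ge (u : R) : (u%:E < (two_sided_error X i)^-1)%E ->
  \forall n \near \oo, (u%:E <= mean_trace_inv X n)%E.
Proof.
have [u0 _|u0] := leP u 0.
  apply: nearW => n; apply: (@le_trans _ _ 0%E); first by rewrite lee_fin.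
  rewrite mule_ge0 ?lee_fin ?invr_ge0// /trace_inv cov_mxE//.
  by case: ifPn => // Cu; rewrite lee_fin sumr_ge0// => k _; exact: y_ge0.
rewrite inve_pgt ?inE ?lee_fin ?(ltW u0)//; last exact: two_sided_error_ge0.
rewrite inver gt_eqF// => /(two_sided_error_window hX)[m [q [qu qP]]].
have uq1 : u * q < 1 by move: qu; rewrite lte_fin -ltr_pdivlMl ?mulr1.
near=> n.
have n_gt0 : (0 < n)%N by near: n; exact: nbhs_infty_gt.
(* Equivalent to [u q n <= n - 2 m]. *)
have n_big : (m + m)%:R / (1 - u * q) <= n%:R.
  by near: n; exact: nbhs_infty_ger.
have nm : (m + m < n)%N by near: n; exact: nbhs_infty_gt.
rewrite /mean_trace_inv /trace_inv cov_mxE//; case: ifPn => [Cu|_]; last first.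
  by rewrite gt0_muley ?leey// lte_fin invr_gt0 ltr0n.
rewrite -EFinM lee_fin ler_pdivlMl ?ltr0n//.
have q_ge0 : 0 <= q.
  have mn : (m < n)%N by lia.
  by have [|x _ <-] := qP n (Ordinal mn) (leqnn m); [by []|exact: Cpsd].
have yq (k : 'I_n) : (m <= k)%N -> (k + m < n)%N -> 1 <= invmx (C n) k k * q.
  move=> mk kmn; have [x xk1 <-] := qP n k mk kmn.
  exact: invmx_diag_form_ge1.
have trq : (n - (m + m))%:R <= \tr (invmx (C n)) * q.
  rewrite /mxtrace mulr_suml.
  have nE : n = (m + (n - (m + m) + m))%N by lia.
  (* The diagonal, extended by 0 to all naturals so that the sum can be cut at [m] and [n - m]. *)
  pose F k := if insub k is Some k' then invmx (C n) k' k' * q else 0.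
  have F0 k : 0 <= F k.
    by rewrite /F; case: insub => // k'; rewrite mulr_ge0// y_ge0.
  rewrite (eq_bigr (F \o val)); last by move=> k _; rewrite /F/= valK.
  rewrite -(big_mkord xpredT F) (@big_cat_nat _ _ _ m)//=; last by lia.
  rewrite (@big_cat_nat _ _ _ (n - m) m)//=; [|lia|lia].
  rewrite -[leLHS]add0r lerD ?sumr_ge0// -[leLHS]addr0 lerD ?sumr_ge0//.
  have -> : (n - (m + m))%N = (n - m - m)%N by lia.
  rewrite -mulr_natl mulr1 -[leLHS]mulr1 mulr_natl -sumr_const_nat.
  rewrite [leLHS]big_nat_cond [leRHS]big_nat_cond; apply: ler_sum => k.
  rewrite andbT => /andP[mk knm].
  have kn : (k < n)%N by lia.
  by rewrite /F insubT yq//=; lia.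
(* If [q = 0], then [trq] would bound the positive number [n - 2 m] by 0. *)
have q_gt0 : 0 < q.
  have p0 : 0 < (n - (m + m))%:R :> R by rewrite ltr0n subn_gt0.
  rewrite lt_neqAle q_ge0 andbT; apply: contraTneq trq => <-.
  by rewrite mulr0 -ltNge.
rewrite -(ler_pM2r q_gt0); apply: le_trans trq.
rewrite natrB ?(ltnW nm)//; move: n_big.
rewrite ler_pdivrMr ?subr_gt0//; lra.
Unshelve. all: by end_near. Qed.

Lemma mean_trace_inv_cvg :
  mean_trace_inv X n @[n --> \oo] --> ((two_sided_error X i)^-1)%E.
Proof. exact: cvge_from_below mean_trace_inv_le mean_trace_inv_ge. Qed.

End mean_trace.

(** * Integrals of trigonometric sums over one period *)

Definition harm_cos (R : realType) (m : int) (f : R) : R :=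
  cos (2 * pi * f * m%:~R).

Definition harm_sin (R : realType) (m : int) (f : R) : R :=
  sin (2 * pi * f * m%:~R).

Lemma harm_cosN (R : realType) (m : int) (f : R) :
  harm_cos (- m) f = harm_cos m f.
Proof. by rewrite /harm_cos mulrNz mulrN cosN. Qed.

Lemma harm_cosB (R : realType) (k l : int) (f : R) : harm_cos (k - l) f =
  harm_cos k f * harm_cos l f + harm_sin k f * harm_sin l f.
Proof. by rewrite /harm_cos rmorphB/= mulrBr cosB. Qed.

Lemma harm_cosM (R : realType) (k l : int) (f : R) :
  harm_cos k f * harm_cos l f = 2^-1 * (harm_cos (k + l) f + harm_cos (k - l) f).
Proof.
rewrite harm_cosB -[l in k + l]opprK harm_cosB harm_cosN.
by rewrite /harm_sin rmorphN/= mulrN sinN; field.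
Qed.

Lemma sin_pi_int (R : realType) (m : int) : sin (pi * m%:~R) = 0 :> R.
Proof.
have sinn n : sin (pi * n%:R) = 0 :> R.
  by rewrite mulr_natr -[_ *+ _]add0r alternatingn ?sin0 ?mulr0//; exact: sinDpi.
by case: m => n; rewrite ?NegzE ?mulrNz ?mulrN ?sinN -?pmulrn sinn ?oppr0.
Qed.

Lemma continuous_harm_cos (R : realType) (m : int) :
  continuous (harm_cos m : R -> R).
Proof.
move=> f; apply: (@continuous_comp _ _ _ (fun f : R => 2 * pi * f * m%:~R) cos).
  apply: cvgMl; apply: cvgMr; exact: cvg_id.
exact: continuous_cos.
Qed.

Lemma integral_harm_cos (R : realType) (m : int) :
  (\int[lebesgue_measure]_(f in `[(- 2^-1)%R, (2^-1)%R]) (harm_cos m f : R)%:E =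
   ((m == 0)%:R)%:E)%E.
Proof.
have [->|m0] := eqVneq m 0.
  under eq_integral do rewrite /harm_cos mulr0 cos0.
  rewrite integral_cst//= mul1e lebesgue_measure_itv/= lte_fin.
  rewrite ifT; last lra.
  by rewrite -EFinB; congr EFin; lra.
pose w : R := 2 * pi * m%:~R.
have w0 : w != 0 by rewrite /w !mulf_neq0// ?pnatr_eq0 ?intr_eq0// gt_eqF// pi_gt0.
(* This antiderivative vanishes at both endpoints, since [w / 2 = pi m]. *)
pose F (f : R) : R := w^-1 * sin (w * f).
have dF (f : R) : is_derive f 1 F (harm_cos m f).
  rewrite /F; apply: is_derive_eq.
  rewrite /harm_cos /GRing.scale/= mulr1 mulrCA mulVf// mulr1.
  by congr cos; rewrite /w; ring.
have cF : continuous F.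
  move=> x; apply: differentiable_continuous; apply/derivable1_diffP.
  by have [] := dF x.
rewrite (@continuous_FTC2 _ _ F).
- rewrite -EFinB /F -mulrBr mulrN sinN.
  have -> : w * 2^-1 = pi * m%:~R by rewrite /w; field.
  by rewrite sin_pi_int oppr0 subr0 mulr0.
- lra.
- by apply: continuous_subspaceT; exact: continuous_harm_cos.
- split => [x _||].
  + by have [] := dF x.
  + exact/cvg_at_right_filter/cF.
  + exact/cvg_at_left_filter/cF.
- by move=> x _; rewrite derive1E; have [] := dF x.
Qed.

Lemma integrable_harm_cos (R : realType) (m : int) :
  lebesgue_measure.-integrable `[(- 2^-1 : R)%R, (2^-1)%R]
    (EFin \o (harm_cos m : R -> R)).
Proof.
apply: continuous_compact_integrable; first exact: segment_compact.
by apply: continuous_subspaceT; exact: continuous_harm_cos.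
Qed.

(** Frequencies may repeat over the index type, so multiple sums can be integrated without
    collecting terms. *)
Lemma integral_trig_sum (R : realType) (I : finType) (b : I -> R) (m : I -> int) :
  (\int[lebesgue_measure]_(f in `[(- 2^-1)%R, (2^-1)%R])
     (\sum_p b p * harm_cos (m p) f)%R%:E =
   (\sum_p b p * (m p == 0)%:R)%R%:E)%E.
Proof.
under eq_integral do rewrite -sumEFin.
rewrite integral_sum//; last first.
  move=> p.
  by apply: eq_integrable (integrableZl _ (b p) (integrable_harm_cos R (m p))).
rewrite -sumEFin; apply: eq_bigr => p _.
under eq_integral do rewrite EFinM.
rewrite integralZl; [|by []|exact: integrable_harm_cos].
by rewrite integral_harm_cos -EFinM.
Qed.

Lemma measurable_trig_sum (R : realType) (I : finType) (b : I -> R) (m : I -> int)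
    (D : set R) : measurable_fun D (fun f => \sum_p b p * harm_cos (m p) f).
Proof.
apply: measurable_sum => p; apply: measurable_funM => //.
apply: measurable_funTS; apply: continuous_measurable_fun.
exact: continuous_harm_cos.
Qed.

Lemma integrable_trig_sum (R : realType) (I : finType) (b : I -> R) (m : I -> int) :
  lebesgue_measure.-integrable `[(- 2^-1 : R)%R, (2^-1)%R]
    (fun f => (\sum_p b p * harm_cos (m p) f)%R%:E).
Proof.
have -> : (fun f => (\sum_p b p * harm_cos (m p) f)%:E) =
  (fun f : R => \sum_p (b p)%:E * (harm_cos (m p) f)%:E)%E.
  by apply/funext => f; rewrite -sumEFin.
apply: integrable_sum => // p _.
exact: (integrableZl _ (b p) (integrable_harm_cos R (m p))).
Qed.

(** * Reciprocals with values in the extended reals *)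

Lemma measurable_inve (R : realType) (D : set R) (g : R -> R) :
  measurable D -> measurable_fun D g -> (forall x, 0 <= g x) ->
  measurable_fun D (fun x => ((g x)%:E^-1)%E).
Proof.
move=> mD mg g0.
apply: (@eq_measurable_fun _ _ _ _ _
   (fun x => if g x == 0 then +oo%E else ((g x `^ (-1))%:E))).
  by move=> x _; rewrite inver powR_inv1.
apply: measurable_fun_if => //.
- by apply: measurable_fun_eqr.
- apply/measurable_EFinP.
  apply: (@measurableT_comp _ _ _ _ _ _ (fun x : R => x `^ (-1)) _ g).
    exact: measurable_powR.
  by apply: measurable_funS mg => //; exact: subIsetl.
Qed.

(** Nonnegativity matters at [l = 0]: the reciprocals then tend to [+oo], and terms with [u n = 0]
    already equal [+oo]. *)
Lemma cvg_inve_ge0 (R : realType) (u : R^nat) (l : R) :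
  (forall n, 0 <= u n) -> u @ \oo --> l ->
  ((u n)%:E^-1)%E @[n --> \oo] --> (l%:E^-1)%E.
Proof.
move=> u0 ul; have l0 : 0 <= l.
  by rewrite -(cvg_lim (@Rhausdorff R) ul) limr_ge//; [exact: cvgP ul|exact: nearW].
have [l_eq0|l_neq0] := eqVneq l 0.
  rewrite l_eq0 inve0; apply/cvgeyPge => A; near=> n.
  rewrite inver; case: ifPn => [_|un0]; first by rewrite leey.
  have un_lt : u n < (`|A| + 1)^-1.
    near: n; apply: (cvgr_lt _ ul); rewrite l_eq0 invr_gt0.
    by rewrite ltr_wpDl.
  rewrite lee_fin (le_trans (ler_norm A))// (@le_trans _ _ (`|A| + 1)) ?lerDl//.
  have un_gt0 : 0 < u n by rewrite lt_neqAle eq_sym un0 u0.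
  by rewrite -[leLHS]invrK lef_pV2 ?posrE ?invr_gt0 ?ltr_wpDl// ltW.
have l_gt0 : 0 < l by rewrite lt_neqAle eq_sym l_neq0.
rewrite inver (negPf l_neq0).
have ulV := cvgV l_neq0 ul.
have un_gt0 : \forall n \near \oo, 0 < u n by exact: (cvgr_gt _ ul).
apply/fine_cvgP; split.
  by near=> n; rewrite inver gt_eqF//; near: n.
apply: cvg_trans; last exact: ulV. apply: near_eq_cvg; near=> n.
by rewrite /= inver gt_eqF//=; near: n.
Unshelve. all: by end_near. Qed.

(** * Fejer means by Cesaro summation *)

(** The new column carries the differences [-n, ..., -1] and the new row [0, ..., n], each once. *)
Lemma toeplitz_sumS (V : nmodType) (g : int -> V) n :
  \sum_(i < n.+1) \sum_(j < n.+1) g (i%:Z - j%:Z) =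
  \sum_(i < n) \sum_(j < n) g (i%:Z - j%:Z) +
  \sum_(j < n.*2.+1) g (j%:Z - n%:Z).
Proof.
rewrite big_ord_recr/=; under eq_bigr do rewrite big_ord_recr/=.
rewrite big_split/= -addrA; congr (_ + _).
have -> : n.*2.+1 = (n + n.+1)%N by lia.
rewrite big_split_ord/=; congr (_ + _).
rewrite (reindex_inj rev_ord_inj)/=; apply: eq_bigr => j _.
by congr g; have := ltn_ord j; lia.
Qed.

(** Adding borders one at a time shows the double sum to be the sum of the symmetric partial sums of
    orders [0, ..., n]. *)
Lemma cesaro_toeplitz (R : realType) (g : int -> R) (l : R) :
  \sum_(j < N.*2.+1) g (j%:Z - N%:Z) @[N --> \oo] --> l ->
  n.+1%:R^-1 * (\sum_(i < n.+1) \sum_(j < n.+1) g (i%:Z - j%:Z))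
    @[n --> \oo] --> l.
Proof.
move=> /cesaro; set s := arithmetic_mean _ => sl.
suff -> : (fun n => n.+1%:R^-1 *
  (\sum_(i < n.+1) \sum_(j < n.+1) g (i%:Z - j%:Z))) = s by [].
apply/funext => n; rewrite /s /arithmetic_mean/=; congr (_ * _).
rewrite /series/=; elim: (n.+1) => [|k IHk]; first by rewrite big_ord0 big_geq.
by rewrite toeplitz_sumS IHk big_nat_recr.
Qed.

Lemma cvg_Re (R : realType) (u : nat -> R[i]) (l : R) :
  u @ \oo --> (real_complex R l : R[i]^o) -> complex.Re (u n) @[n --> \oo] --> l.
Proof.
move=> /(@cvgr_dist_lt _ R[i]^o) ul; apply/cvgrPdist_lt => e e0.
have e0' : 0 < real_complex R e by rewrite ltcR.
near=> n; rewrite -ltcR.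
have -> : l - complex.Re (u n) = complex.Re (real_complex R l - u n).
  by case: (u n).
apply: le_lt_trans (normc_ge_Re _) _.
by near: n; exact: ul.
Unshelve. all: by end_near. Qed.

(** Collected by differences, this is the sum over [|m| <= n] of
    [(1 - |m| / (n + 1)) c_m cos(2 pi m f)]; the double sum keeps the quadratic form visible. *)
Definition fejer_mean (R : realType) (c : int -> R) (n : nat) (f : R) : R :=
  n.+1%:R^-1 * (\sum_(i < n.+1) \sum_(j < n.+1)
    c (i%:Z - j%:Z) * harm_cos (i%:Z - j%:Z) f).

Lemma fejer_mean_cvg (R : realType) (c : int -> R) (S : R -> R) :
  is_psd c S -> forall f, fejer_mean c n f @[n --> \oo] --> S f.
Proof.
move=> cS f; apply: (cesaro_toeplitz (g := fun m => c m * harm_cos m f)).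
suff -> : (fun N => \sum_(j < N.*2.+1)
    c (j%:Z - N%:Z) * harm_cos (j%:Z - N%:Z) f) =
  (fun N => complex.Re (psd_partial c f N)) by exact/cvg_Re/cS.
apply/funext => N; rewrite /psd_partial.
rewrite (big_morph (@complex.Re R) (id1 := 0) (op1 := +%R))//; last by case=> ? ? [].
by apply: eq_bigr => k _; rewrite /= mul0r subr0 /harm_cos cosN.
Qed.

(** The real part of [v^* A v] for [v = (e^(2 pi j f (k - s)))_k], split into the real and imaginary
    parts of [v]. *)
Lemma mxform_trig (R : realType) n (A : 'M[R]_n) (s : int) (f : R) :
  \sum_(i < n) \sum_(j < n) A i j * harm_cos (i%:Z - j%:Z) f =
  mxform A (\row_k harm_cos (k%:Z - s) f) + mxform A (\row_k harm_sin (k%:Z - s) f).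
Proof.
rewrite !mxformE -big_split; apply: eq_bigr => i _ /=.
rewrite -big_split; apply: eq_bigr => j _ /=; rewrite !mxE -mulrDl -harm_cosB.
by rewrite mulrC opprB addrA subrK.
Qed.

Lemma fejer_mean_form (R : realType) (c : int -> R) n (f : R) :
  fejer_mean c n f = n.+1%:R^-1 *
   (mxform (toeplitz_mx c n.+1) (\row_k harm_cos (k%:Z - 0) f)
    + mxform (toeplitz_mx c n.+1) (\row_k harm_sin (k%:Z - 0) f)).
Proof.
rewrite -mxform_trig /fejer_mean; congr (_ * _).
by apply: eq_bigr => i _; apply: eq_bigr => j _; rewrite mxE.
Qed.

Lemma fejer_mean_ge0 (R : realType) (c : int -> R) n (f : R) :
  (forall x : 'rV_n.+1, 0 <= mxform (toeplitz_mx c n.+1) x) ->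
  0 <= fejer_mean c n f.
Proof.
by move=> cpsd; rewrite fejer_mean_form mulr_ge0 ?invr_ge0// addr_ge0.
Qed.

Lemma measurable_trig_form (R : realType) n (A : 'I_n -> 'I_n -> R) (D : set R) :
  measurable_fun D (fun f : R =>
    \sum_(i < n) \sum_(j < n) A i j * harm_cos (i%:Z - j%:Z) f).
Proof.
under eq_fun do rewrite pair_big/=.
exact: (measurable_trig_sum (fun p => A p.1 p.2) (fun p => p.1%:Z - p.2%:Z)).
Qed.

Lemma measurable_fejer_mean (R : realType) (c : int -> R) n (D : set R) :
  measurable_fun D (fejer_mean c n).
Proof.
apply: measurable_funM => //.
exact: (measurable_trig_form (fun i j : 'I_n.+1 => c (i%:Z - j%:Z))).
Qed.

(* This is [v^* C^-1 v >= (v^* v)^2 / (v^* C v)] for the vector [v] of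
   harmonics. *)
Lemma fejer_mean_inv_le (R : realType) (c : int -> R) n (f : R) :
  let C := toeplitz_mx c n.+1 in
  (forall m, c (- m) = c m) -> (forall x, 0 <= mxform C x) -> C \in unitmx ->
  ((fejer_mean c n f)%:E^-1 <= (n.+1%:R^-1 * \sum_(i < n.+1) \sum_(j < n.+1)
     invmx C i j * harm_cos (i%:Z - j%:Z) f)%:E)%E.
Proof.
move=> C cN Cpsd Cu; rewrite (mxform_trig _ 0) fejer_mean_form -/C.
set u := \row_k _; set v := \row_k _.
have uv : (u *m u^T) 0 0 + (v *m v^T) 0 0 = n.+1%:R.
  rewrite !mxE -big_split/= -[in RHS](card_ord n.+1) -sumr_const.
  by apply: eq_bigr => k _; rewrite !mxE -!expr2 /harm_cos /harm_sin cos2Dsin2.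
set N := mxform C u + _; set G := mxform _ u + _.
(* [mxform_invmx_ge] for the cosine row and the sine row with the same [t], added and divided by
   [n + 1]. *)
have ineq t : 2 * t <= n.+1%:R^-1 * G + t ^+ 2 * (n.+1%:R^-1 * N).
  rewrite mulrCA -mulrDr ler_pdivlMl ?ltr0n// -uv.
  have Csym : C^T = C by exact: tr_toeplitz_mx.
  have := mxform_invmx_ge t u u Csym Cpsd Cu.
  have := mxform_invmx_ge t v v Csym Cpsd Cu.
  rewrite /N /G; lra.
have s_ge0 : 0 <= n.+1%:R^-1 * N by rewrite mulr_ge0 ?invr_ge0 ?addr_ge0.
move: ineq s_ge0; move: (_ * N) (_ * G) => s g ineq s_ge0.
have [s_eq0|s_neq0] := eqVneq s 0.
  (* With [s = 0], [t = 1] gives [g >= 2] while [t = g] gives [g <= 0]. *)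
  by exfalso; have := ineq g; have := ineq 1; rewrite s_eq0 !mulr0 !addr0; lra.
rewrite inver (negPf s_neq0) lee_fin; have := ineq s^-1.
by rewrite expr2 -mulrA mulVf// mulr1; lra.
Qed.

(** Integrating the bound of [fejer_mean_inv_le] kills every nonzero frequency; the zero frequency
    sits on the diagonal only and leaves the trace. *)
Lemma integral_fejer_mean_inv_le (R : realType) (c : int -> R) n :
  let C := toeplitz_mx c n.+1 in
  (forall m, c (- m) = c m) -> (forall x, 0 <= mxform C x) ->
  (\int[lebesgue_measure]_(f in `[(- 2^-1)%R, (2^-1)%R]) (fejer_mean c n f)%:E^-1
   <= (n.+1%:R^-1)%:E * trace_inv C)%E.
Proof.
move=> C cN Cpsd; rewrite /trace_inv; case: ifPn => [Cu|_]; last first.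
  by rewrite gt0_muley ?leey// lte_fin invr_gt0 ltr0n.
pose b (p : 'I_n.+1 * 'I_n.+1) := n.+1%:R^-1 * invmx C p.1 p.2.
pose m (p : 'I_n.+1 * 'I_n.+1) := p.1%:Z - p.2%:Z.
have bE (phi : int -> R) : n.+1%:R^-1 *
    (\sum_(i < n.+1) \sum_(j < n.+1) invmx C i j * phi (i%:Z - j%:Z)) =
    \sum_p b p * phi (m p).
  by rewrite pair_big mulr_sumr; apply: eq_bigr => p _; rewrite mulrA.
have trE : \sum_p b p * (m p == 0)%:R = n.+1%:R^-1 * \tr (invmx C).
  rewrite -(bE (fun k => (k == 0)%:R)); congr (_ * _); apply: eq_bigr => i _.
  rewrite (bigD1 i)//= subrr eqxx mulr1 big1 ?addr0// => j ji.
  by rewrite subr_eq0 eqz_nat eq_sym (inj_eq val_inj) (negPf ji) mulr0.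
rewrite -EFinM -trE -integral_trig_sum; apply: ge0_le_integral => //.
- by move=> f _; rewrite inve_ge0 lee_fin fejer_mean_ge0.
- apply: measurable_inve => //; first exact: measurable_fejer_mean.
  by move=> f; exact: fejer_mean_ge0.
- by apply/measurable_EFinP; exact: measurable_trig_sum.
- by move=> f _; rewrite -(bE (fun k => harm_cos k f)); exact: fejer_mean_inv_le.
Qed.

(** * Squared moduli of trigonometric polynomials against Fejer means *)

(* [|p(f)|^2] for [p(f) = sum_k x_k e^(2 pi j f k)] *)
Definition trig_sqr (R : realType) n (x : 'rV[R]_n) (f : R) : R :=
  \sum_(k < n) \sum_(l < n) x 0 k * x 0 l * harm_cos (k%:Z - l%:Z) f.

(** The left side is the squared real part of [p(f) e^(-2 pi j f s)], whose modulus is that of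
    [p(f)]. *)
Lemma trig_sqr_ge (R : realType) n (x : 'rV[R]_n) (s : int) (f : R) :
  (\sum_(k < n) x 0 k * harm_cos (k%:Z - s) f) ^+ 2 <= trig_sqr x f.
Proof.
have -> : trig_sqr x f = (\sum_(k < n) x 0 k * harm_cos (k%:Z - s) f) ^+ 2 +
                        (\sum_(k < n) x 0 k * harm_sin (k%:Z - s) f) ^+ 2.
  rewrite !expr2 !big_distrlr/= -big_split; apply: eq_bigr => k _ /=.
  rewrite -big_split; apply: eq_bigr => l _ /=.
  have -> : k%:Z - l%:Z = (k%:Z - s) - (l%:Z - s) by rewrite opprB addrA subrK.
  by rewrite harm_cosB mulrDr; congr (_ + _); rewrite mulrACA.
by rewrite lerDl sqr_ge0.
Qed.

Lemma trig_sqr_ge0 (R : realType) n (x : 'rV[R]_n) (f : R) : 0 <= trig_sqr x f.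
Proof. exact: le_trans (sqr_ge0 _) (trig_sqr_ge x 0 f). Qed.

Lemma measurable_trig_sqr (R : realType) n (x : 'rV[R]_n) (D : set R) :
  measurable_fun D (trig_sqr x).
Proof. exact: (measurable_trig_form (fun k l => x 0 k * x 0 l)). Qed.

Lemma sum_window_delta (R : nzRingType) (c : int -> R) (e : int) N :
  (`|e| <= N)%N ->
  \sum_(j < N.*2.+1) c (j%:Z - N%:Z) * (e - (j%:Z - N%:Z) == 0)%:R = c e.
Proof.
move=> eN; have jN : (`|(e + N%:Z)%R| < N.*2.+1)%N by lia.
rewrite (bigD1 (Ordinal jN))//= big1 ?addr0.
  have -> : `|(e + N%:Z)%R|%N%:Z - N%:Z = e by lia.
  by rewrite subrr eqxx mulr1.
move=> j /eqP jne; rewrite (_ : _ == 0 = false) ?mulr0//.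
by apply/eqP => h; apply: jne; apply/val_inj => /=; lia.
Qed.

(** As [|p|^2] has frequencies below [m] only, its integral against a symmetric partial sum of order
    [N >= m] is exactly the form. The integrals here are Cesaro means of this eventually constant
    sequence. *)
Lemma cvg_integral_trig_sqr_fejer (R : realType) (c : int -> R) m (x : 'rV[R]_m) :
  (forall k, c (- k) = c k) ->
  (\int[lebesgue_measure]_(f in `[(- 2^-1)%R, (2^-1)%R])
      (trig_sqr x f * fejer_mean c n f)%:E)%E @[n --> \oo] -->
  (mxform (toeplitz_mx c m) x)%:E.
Proof.
move=> cN.
(* The part of the product coming from [c d], after product-to-sum. [phi] is either the cosine at
   [f] or its integral, the indicator of frequency 0. *)
pose g (phi : int -> R) d := \sum_(k < m) \sum_(l < m) x 0 k * x 0 l *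
  (c d * (2^-1 * (phi (k%:Z - l%:Z + d) + phi (k%:Z - l%:Z - d)))).
(* Index of the flattened sum: [(k, l)], [(i, j)], and a boolean choosing the sum or the difference
   of the two frequencies. *)
pose I n := ((('I_m * 'I_m) * ('I_n.+1 * 'I_n.+1)) * bool)%type.
pose b n (p : I n) := x 0 p.1.1.1 * x 0 p.1.1.2 *
  (n.+1%:R^-1 * c (p.1.2.1%:Z - p.1.2.2%:Z) * 2^-1).
pose fr n (p : I n) : int := p.1.1.1%:Z - p.1.1.2%:Z +
  (if p.2 then p.1.2.1%:Z - p.1.2.2%:Z else - (p.1.2.1%:Z - p.1.2.2%:Z)).
have bE n phi : n.+1%:R^-1 * (\sum_(i < n.+1) \sum_(j < n.+1) g phi (i%:Z - j%:Z)) =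
    \sum_(p : I n) b n p * phi (fr n p).
  rewrite pair_bigA/= mulr_sumr.
  under eq_bigr do rewrite /g pair_bigA/= mulr_sumr.
  rewrite exchange_big pair_bigA/=.
  transitivity (\sum_p \sum_t b n (p, t) * phi (fr n (p, t))).
    by apply: eq_bigr => p _; rewrite big_bool /b /fr/=; ring.
  by rewrite pair_bigA; apply: eq_bigr => -[].
have gcos n f : trig_sqr x f * fejer_mean c n f =
    \sum_(p : I n) b n p * harm_cos (fr n p) f.
  rewrite -(bE n (fun k => harm_cos k f)) /fejer_mean mulrCA; congr (_ * _).
  rewrite mulr_sumr; apply: eq_bigr => i _; rewrite mulr_sumr; apply: eq_bigr => j _.
  rewrite /trig_sqr /g mulr_suml; apply: eq_bigr => k _.
  rewrite mulr_suml; apply: eq_bigr => l _.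
  by rewrite -harm_cosM; ring.
have intE n : (\int[lebesgue_measure]_(f in `[(- 2^-1)%R, (2^-1)%R])
    (trig_sqr x f * fejer_mean c n f)%:E)%E = (n.+1%:R^-1 *
    (\sum_(i < n.+1) \sum_(j < n.+1) g (fun k => (k == 0)%:R) (i%:Z - j%:Z)))%:E.
  by under eq_integral do rewrite gcos; rewrite integral_trig_sum bE.
rewrite (funext intE).
apply: cvg_EFin; first exact: nearW.
apply: (@cesaro_toeplitz _ (g (fun k => (k == 0)%:R))).
apply: cvg_near_cst; near=> N.
have mN : (m <= N)%N by near: N; exact: nbhs_infty_ge.
rewrite /g exchange_big mxformE; apply: eq_bigr => k _ /=.
rewrite exchange_big; apply: eq_bigr => l _ /=.
rewrite -mulr_sumr mxE; congr (_ * _).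
under eq_bigr do rewrite mulrCA mulrDr.
have kl : (`|k%:Z - l%:Z| <= N)%N by have := ltn_ord k; have := ltn_ord l; lia.
rewrite -mulr_sumr big_split/= (sum_window_delta c kl).
(* The condition [k - l + d = 0] becomes [(l - k) - d = 0], which selects
   [c (l - k) = c (k - l)]. *)
under eq_bigr => j _.
  rewrite -(eqr_opp _ 0) oppr0 opprD opprB.
  over.
rewrite sum_window_delta; last by lia.
by rewrite -[c (l%:Z - _)]cN opprB; field.
Unshelve. all: by end_near. Qed.

(** * The integral of 1/S and the prediction error *)

Lemma le_limn_einf (R : realType) (u v : (\bar R)^nat) :
  (forall n, (u n <= v n)%E) -> (limn_einf u <= limn_einf v)%E.
Proof.
move=> uv; rewrite !limn_einf_lim; apply: lee_lim; [exact: is_cvg_einfs..|].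
apply: nearW => n; apply: le_ereal_inf_tmp => _ [k /= nk <-].
by apply: le_trans (uv k); apply: ereal_inf_lbound; exists k.
Qed.

Section interpolation_error.
Context (R : realType) (c : int -> R) (S : R -> R).
Hypotheses (cN : forall k, c (- k) = c k)
  (cpsd : forall n (x : 'rV_n), 0 <= mxform (toeplitz_mx c n) x)
  (cS : is_psd c S).

Local Notation D := (`[(- 2^-1)%R, (2^-1)%R]%classic : set R).

Lemma psd_ge0 f : 0 <= S f.
Proof.
rewrite -(cvg_lim (@Rhausdorff R) (@fejer_mean_cvg _ _ _ cS f)) limr_ge//.
  exact: cvgP (@fejer_mean_cvg _ _ _ cS f).
by apply: nearW => n; exact: fejer_mean_ge0.
Qed.

Lemma measurable_psd : measurable_fun D S.
Proof.
apply: (@measurable_fun_cvg _ _ _ D (fejer_mean c)) => //.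
  by move=> n; exact: measurable_fejer_mean.
by move=> f _; exact: fejer_mean_cvg.
Qed.

Lemma integral_trig_sqr_psd_le m (x : 'rV[R]_m) :
  (\int[lebesgue_measure]_(f in D) (trig_sqr x f * S f)%:E <=
   (mxform (toeplitz_mx c m) x)%:E)%E.
Proof.
have := @cvg_integral_trig_sqr_fejer _ _ _ x cN => /cvg_limn_einf_sup[<- _].
apply: le_trans (fatou _ _ _ _) => //; last 2 first.
- move=> n; apply/measurable_EFinP; apply: measurable_funM.
    exact: measurable_trig_sqr.
  exact: measurable_fejer_mean.
- by move=> n f _; rewrite lee_fin mulr_ge0 ?trig_sqr_ge0 ?fejer_mean_ge0.
rewrite le_eqVlt; apply/orP; left; apply/eqP; apply: eq_integral => f _.
apply/esym; apply: (cvg_limn_einf_sup _).1.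
apply: cvg_EFin; first exact: nearW.
apply: cvgM; [exact: cvg_cst|exact: fejer_mean_cvg].
Qed.

Lemma integral_psd_inv_le :
  (\int[lebesgue_measure]_(f in D) (S f)%:E^-1 <=
   limn_einf (fun n => (n.+1%:R^-1)%:E * trace_inv (toeplitz_mx c n.+1)))%E.
Proof.
apply: (@le_trans _ _ (limn_einf (fun n =>
  \int[lebesgue_measure]_(f in D) (fejer_mean c n f)%:E^-1)%E)); last first.
  by apply: le_limn_einf => n; exact: integral_fejer_mean_inv_le.
have mF n : measurable_fun D (fun f => ((fejer_mean c n f)%:E^-1)%E).
  apply: measurable_inve => //; first exact: measurable_fejer_mean.
  by move=> f; exact: fejer_mean_ge0.
have F0 n f : D f -> (0 <= (fejer_mean c n f)%:E^-1)%E.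
  by move=> _; rewrite inve_ge0 lee_fin fejer_mean_ge0.
have mD : measurable (D : set (measurableTypeR R)) by [].
have := @fatou _ _ _ lebesgue_measure _ mD _ mF F0; apply: le_trans.
rewrite le_eqVlt; apply/orP; left; apply/eqP; apply: eq_integral => f _.
apply/esym; apply: (cvg_limn_einf_sup _).1.
apply: cvg_inve_ge0; last exact: fejer_mean_cvg.
by move=> n; exact: fejer_mean_ge0.
Qed.

(** Cauchy-Schwarz, obtained as an inequality for every [t > 0] in which zeros of [S] are harmless;
    [t] is chosen at the end. *)
Lemma psd_inv_form_ge1 m (x : 'rV[R]_m) (k0 : 'I_m) (r : R) : x 0 k0 = 1 ->
  (\int[lebesgue_measure]_(f in D) (S f)%:E^-1 = r%:E)%E ->
  1 <= r * mxform (toeplitz_mx c m) x.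
Proof.
move=> xk0 Sr; set q := mxform _ x.
pose A (f : R) := \sum_(k < m) x 0 k * harm_cos (k%:Z - k0%:Z) f.
have AE f : 2 * A f = \sum_(k < m) (2 * x 0 k) * harm_cos (k%:Z - k0%:Z) f.
  by rewrite /A mulr_sumr; apply: eq_bigr => k _; rewrite mulrA.
have r0 : 0 <= r.
  rewrite -lee_fin -Sr; apply: integral_ge0 => f _.
  by rewrite inve_ge0 lee_fin psd_ge0.
have mSV : measurable_fun D (fun f => ((S f)%:E^-1)%E).
  by apply: measurable_inve => //; [exact: measurable_psd|exact: psd_ge0].
have mVS : measurable_fun D (fun f => (trig_sqr x f * S f)%:E).
  apply/measurable_EFinP/measurable_funM; last exact: measurable_psd.
  exact: measurable_trig_sqr.
have VS0 f : 0 <= trig_sqr x f * S f by rewrite mulr_ge0 ?trig_sqr_ge0 ?psd_ge0.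
have SV0 f : (0 <= (S f)%:E^-1)%E by rewrite inve_ge0 lee_fin psd_ge0.
have ineq t : 0 < t -> 2 <= t * q + t^-1 * r.
  move=> t0; pose G (f : R) :=
    (t%:E * (trig_sqr x f * S f)%:E + t^-1%:E * (S f)%:E^-1)%E.
  (* AM-GM: [2 A <= t A^2 S + 1 / (t S)] with [A^2 <= |p|^2] *)
  have AG f : ((2 * A f)%:E <= G f)%E.
    (* Where [S f = 0], the right side is [+oo]. *)
    rewrite /G inver; case: ifPn => [_|Sf0].
      by rewrite gt0_muley ?lte_fin ?invr_gt0// -EFinM addey// leey.
      rewrite -!EFinM -EFinD lee_fin.
    have A2 : A f ^+ 2 <= trig_sqr x f by exact: trig_sqr_ge.
    have S0 : 0 < S f by rewrite lt_neqAle eq_sym Sf0 psd_ge0.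
    have tA : t * A f ^+ 2 * S f <= t * (trig_sqr x f * S f).
      by rewrite -mulrA ler_pM2l// ler_pM2r.
    apply: le_trans (lerD tA (lexx _)).
    rewrite -subr_ge0.
    have -> : t * A f ^+ 2 * S f + t^-1 * (S f)^-1 - 2 * A f =
        (t * S f)^-1 * (t * S f * A f - 1) ^+ 2.
      by field; rewrite Sf0 gt_eqF.
    by rewrite mulr_ge0 ?sqr_ge0// invr_ge0 ltW// mulr_gt0.
  have Gint : (\int[lebesgue_measure]_(f in D) G f =
      t%:E * (\int[lebesgue_measure]_(f in D) (trig_sqr x f * S f)%:E) +
      (t^-1 * r)%:E)%E.
    rewrite ge0_integralD//.
    - rewrite ge0_integralZl//;
        [|by move=> f _; rewrite lee_fin|by rewrite lee_fin ltW].
      by rewrite ge0_integralZl// ?lee_fin ?invr_ge0 ?ltW// Sr EFinM.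
    - by move=> f _; rewrite mule_ge0// lee_fin// ltW.
    - exact: measurable_funeM.
    - by move=> f _; rewrite mule_ge0// lee_fin invr_ge0 ltW.
    - exact: measurable_funeM.
  have Gle : (\int[lebesgue_measure]_(f in D) G f <= (t * q + t^-1 * r)%:E)%E.
    rewrite Gint EFinD leeD2r// EFinM lee_pmul2l//.
    exact: integral_trig_sqr_psd_le.
  rewrite -lee_fin; apply: (le_trans _ Gle).
  (* Only the term [k = k0] has frequency 0, and its coefficient is [2 * x 0 k0 = 2]. *)
  have Aint : (\int[lebesgue_measure]_(f in D) (2 * A f)%:E = 2%:E)%E.
    under eq_integral do rewrite AE.
    rewrite integral_trig_sum (bigD1 k0)//= subrr eqxx xk0 big1 ?addr0 ?mulr1//.
    move=> k kk0.
    by rewrite subr_eq0 eqz_nat (inj_eq val_inj) (negPf kk0) mulr0.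
  rewrite -Aint; apply: le_integral => //.
  - rewrite (_ : (fun f => _) = fun f => (\sum_(k < m)
      (2 * x 0 k) * harm_cos (k%:Z - k0%:Z) f)%:E); last first.
      by apply/funext => f; rewrite AE.
    exact: integrable_trig_sum.
  - apply/integrableP; split.
      by apply: emeasurable_funD; exact: measurable_funeM.
    under eq_integral => f _ do
      rewrite gee0_abs ?adde_ge0 ?mule_ge0 ?lee_fin ?invr_ge0 ?(ltW t0)//.
    exact: le_lt_trans Gle (ltry _).
have q0 : 0 <= q by exact: cpsd.
have [r_gt0|] := ltP 0 r.
  (* [t = r] gives [2 <= r q + 1]. *)
  by have := ineq r r_gt0; rewrite mulVf ?gt_eqF//; lra.
move=> r_le0; have r_eq0 : r = 0 by apply/eqP; rewrite eq_le r0 r_le0.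
(* For [r = 0], [t = 1 / (q + 1)] would give [2 <= t q < 1]. *)
have q1 : 0 < (q + 1)^-1 by rewrite invr_gt0; lra.
have := ineq _ q1; rewrite r_eq0 mulr0 addr0.
have -> : (q + 1)^-1 * q = 1 - (q + 1)^-1 by field; rewrite gt_eqF//; lra.
lra.
Qed.

End interpolation_error.

Theorem lemma4 (d : measure_display) (T : measurableType d) (R : realType)
    (P : probability T R) (X : int -> {RV P >-> R}) (S : R -> R) (i : int)
    (hX : zero_mean_wss X) (hS : is_psd (autocov X) S) :
  [/\ cvgn (mean_trace_inv X),
      limn (mean_trace_inv X) = ((two_sided_error X i)^-1)%E
    & ((two_sided_error X i)^-1)%E =
      (\int[lebesgue_measure]_(f in `[(- 2^-1)%R, (2^-1)%R]) ((S f)%:E)^-1)%E].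
Proof.
have Mcvg := @mean_trace_inv_cvg _ _ _ _ X i hX.
have cN := autocovN hX.
have cpsd n (x : 'rV_n) := @toeplitz_autocov_ge0 _ _ _ _ X n x hX.
split; [exact: cvgP Mcvg|exact: cvg_lim Mcvg|].
apply/eqP; rewrite eq_le; apply/andP; split; last first.
  apply: le_trans (integral_psd_inv_le cN cpsd hS) _.
  suff /cvg_limn_einf_sup[-> _] : ((n.+1%:R^-1)%:E *
      trace_inv (toeplitz_mx (autocov X) n.+1))%E @[n --> \oo] -->
      ((two_sided_error X i)^-1)%E by [].
  have -> : (fun n => (n.+1%:R^-1)%:E * trace_inv (toeplitz_mx (autocov X) n.+1))%E =
      (fun n => mean_trace_inv X n.+1).
    by apply/funext => n; rewrite -cov_mxE.
  by rewrite (cvg_shiftS (mean_trace_inv X)).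
have : (0 <= \int[lebesgue_measure]_(f in `[(- 2^-1)%R, (2^-1)%R]) ((S f)%:E)^-1)%E.
  by apply: integral_ge0 => f _; rewrite inve_ge0 lee_fin (@psd_ge0 _ _ _ cpsd hS).
(* An infinite integral makes the remaining inequality trivial. *)
case Sr : (\int[_]_(f in _) _)%E => [r| |] //; last by move=> _; rewrite leey.
move=> r0.
rewrite inve_ple ?inE//; last exact: two_sided_error_ge0.
(* Otherwise some predictor has error [q < 1 / r], so that [r q < 1] contradicts
   [psd_inv_form_ge1]. *)
rewrite leNgt; apply/negP => /(two_sided_error_window hX)[m [q [qr qP]]].
have mm : (m < m + m.+1)%N by lia.
have mm' : (Ordinal mm + m < m + m.+1)%N by rewrite /=; lia.
have [x xk1 xq] := qP _ (Ordinal mm) (leqnn m) mm'.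
have := psd_inv_form_ge1 cN cpsd hS xk1 Sr; rewrite xq leNgt => /negP; apply.
(* For [r = 0] the bound [q < 1 / r = +oo] carries no information, but [r q = 0 < 1] directly. *)
move: qr r0; rewrite inver lee_fin; case: ifPn => [/eqP -> _ _|rn0].
  by rewrite mul0r ltr01.
rewrite lte_fin => qr r0; have r_gt0 : 0 < r by rewrite lt_neqAle eq_sym rn0.
by rewrite -ltr_pdivlMl// mulr1.
Qed.
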